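(* Let $L_n$ be as in the context. Then $\operatorname{Aut}(L_3)\cong L_3$ and $\operatorname{Out}(L_3)=1$, while for $n\ge 4$ $$\operatorname{Aut}(L_n)\cong\big(L_n\rtimes(\mathbb Z/2\mathbb Z)^{n-3}\big)\rtimes S_{n-2},\qquad \operatorname{Out}(L_n)\cong(\mathbb Z/2\mathbb Z)^{n-3}\rtimes S_{n-2}.$$
   Context: For $n\ge 2$, $L_n=\langle y_1,\dots,y_{n-1}\mid y_j^2=1\ (1\le j\le n-1),\ y_iy_{i+1}y_i=y_{i+1}y_iy_{i+1}\ (1\le i\le n-2)\rangle$ (no relations between $y_i,y_j$ with $|i-j|\ge 2$). $S_k$ is the symmetric group on $k$ letters. *)

(* Defs.v *)
(* (boot + fingroup/perm for S_k), with Stdlib setoid classes.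
   Groups here are possibly infinite, so we use a light "setoid group"
   formalism: a carrier with an equivalence relation and the group
   operations; the group presented by generators and relations is the
   free monoid on the generators modulo the congruence generated by the
   relations. *)
From Stdlib Require Import RelationClasses Relation_Operators.
From mathcomp Require Import all_boot all_fingroup.
Set Implicit Arguments. Unset Strict Implicit. Unset Printing Implicit Defensive.

Record grp := Grp {
  car :> Type;
  geq : car -> car -> Prop;
  gmul : car -> car -> car;
  ginv : car -> car;
  gone : car;
  geq_equiv : Equivalence geq }.

Arguments geq {g}.
Arguments gmul {g}.
Arguments ginv {g}.
Arguments gone {g}.

Section GeqLemmas.
Variable G : grp.
Lemma geq_refl (x : G) : geq x x.
Proof. exact: (@Equivalence_Reflexive _ _ (geq_equiv G)). Qed.
Lemma geq_sym (x y : G) : geq x y -> geq y x.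
Proof. exact: (@Equivalence_Symmetric _ _ (geq_equiv G)). Qed.
Lemma geq_trans (x y z : G) : geq x y -> geq y z -> geq x z.
Proof. exact: (@Equivalence_Transitive _ _ (geq_equiv G)). Qed.
End GeqLemmas.

Definition iso (A B : grp) : Prop :=
  exists (f : A -> B) (g : B -> A),
    (forall x y, geq x y -> geq (f x) (f y)) /\
    (forall x y, geq x y -> geq (g x) (g y)) /\
    (forall x y, geq (f (gmul x y)) (gmul (f x) (f y))) /\
    (forall x, geq (g (f x)) x) /\
    (forall y, geq (f (g y)) y).

(* Generators y_1, ..., y_{n-1} are encoded as the ordinals 0, ..., n-2
   of type 'I_n.-1 (y_{i+1} <-> i).  Words are sequences of generators. *)
Inductive ln_rel (n : nat) : seq 'I_n.-1 -> seq 'I_n.-1 -> Prop :=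
| ln_refl w : ln_rel w w
| ln_sym u v : ln_rel u v -> ln_rel v u
| ln_trans u v w : ln_rel u v -> ln_rel v w -> ln_rel u w
| ln_sq (u v : seq 'I_n.-1) (i : 'I_n.-1) :
    ln_rel (u ++ [:: i; i] ++ v) (u ++ v)
| ln_braid (u v : seq 'I_n.-1) (i j : 'I_n.-1) :
    val j = (val i).+1 ->
    ln_rel (u ++ [:: i; j; i] ++ v) (u ++ [:: j; i; j] ++ v).

Lemma ln_rel_equiv n : Equivalence (@ln_rel n).
Proof.
split; first exact: ln_refl; first exact: ln_sym.
move=> x y z; exact: ln_trans.
Qed.

(* Inverse of a word: reverse it (each generator is an involution). *)
Definition Ln (n : nat) : grp :=
  @Grp (seq 'I_n.-1) (@ln_rel n) (fun u v => u ++ v) (@rev _) [::]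
       (ln_rel_equiv n).

Record auto (G : grp) := Auto {
  af : G -> G;
  ag : G -> G;
  af_proper : forall x y, geq x y -> geq (af x) (af y);
  ag_proper : forall x y, geq x y -> geq (ag x) (ag y);
  af_hom : forall x y, geq (af (gmul x y)) (gmul (af x) (af y));
  ag_hom : forall x y, geq (ag (gmul x y)) (gmul (ag x) (ag y));
  agf : forall x, geq (ag (af x)) x;
  afg : forall x, geq (af (ag x)) x }.

Section AutGroup.
Variable G : grp.

Definition auto_eq (f g : auto G) : Prop := forall x, geq (af f x) (af g x).

Lemma auto_eq_equiv : Equivalence auto_eq.
Proof.
split.
- by move=> f x; apply: geq_refl.
- by move=> f g H x; apply: geq_sym.
- by move=> f g h H1 H2 x; apply: geq_trans (H1 x) (H2 x).
Qed.

Program Definition auto_mul (f g : auto G) : auto G :=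
  @Auto G (fun x => af f (af g x)) (fun x => ag g (ag f x)) _ _ _ _ _ _.
Next Obligation. by apply: af_proper; apply: af_proper. Qed.
Next Obligation. by apply: ag_proper; apply: ag_proper. Qed.
Next Obligation.
apply: geq_trans (af_hom _ _ _); apply: af_proper; exact: af_hom.
Qed.
Next Obligation.
apply: geq_trans (ag_hom _ _ _); apply: ag_proper; exact: ag_hom.
Qed.
Next Obligation.
apply: geq_trans (agf g x); apply: ag_proper; exact: agf.
Qed.
Next Obligation.
apply: geq_trans (afg f x); apply: af_proper; exact: afg.
Qed.

Program Definition auto_inv (f : auto G) : auto G :=
  @Auto G (ag f) (af f) _ _ _ _ _ _.
Next Obligation. exact: ag_proper. Qed.
Next Obligation. exact: af_proper. Qed.
Next Obligation. exact: ag_hom. Qed.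
Next Obligation. exact: af_hom. Qed.
Next Obligation. exact: afg. Qed.
Next Obligation. exact: agf. Qed.

Definition auto_one : auto G :=
  @Auto G (fun x => x) (fun x => x) (fun _ _ H => H) (fun _ _ H => H)
    (fun _ _ => geq_refl _) (fun _ _ => geq_refl _)
    (fun _ => geq_refl _) (fun _ => geq_refl _).

Definition AutG : grp :=
  @Grp (auto G) auto_eq auto_mul auto_inv auto_one auto_eq_equiv.

(* Out(G) = Aut(G)/Inn(G): same carrier, f ~ g iff f and g differ by an
   inner automorphism, i.e. f(y) ~ x g(y) x^-1 for all y (for some x).
   We take the equivalence closure; in a group this relation is already
   an equivalence, so the closure changes nothing. *)
Definition inn_rel (f g : auto G) : Prop :=
  exists x : G, forall y, geq (af f y) (gmul (gmul x (af g y)) (ginv x)).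

Lemma out_eq_equiv : Equivalence (clos_refl_sym_trans _ inn_rel).
Proof.
split.
- by move=> x; apply: rst_refl.
- by move=> x y; apply: rst_sym.
- by move=> x y z; apply: rst_trans.
Qed.

Definition OutG : grp :=
  @Grp (auto G) (clos_refl_sym_trans _ inn_rel) auto_mul auto_inv auto_one
       out_eq_equiv.

End AutGroup.

Definition trivial_grp : grp :=
  @Grp unit (@eq unit) (fun _ _ => tt) (fun _ => tt) tt eq_equivalence.

Definition Z2pow (k : nat) : grp :=
  @Grp {ffun 'I_k -> bool} (@eq _) (fun f g => [ffun i => f i (+) g i])
       (fun f => f) [ffun => false] eq_equivalence.

Definition SymG (k : nat) : grp :=
  @Grp {perm 'I_k} (@eq _) (fun s t => (s * t)%g) (fun s => (s^-1)%g) 1%g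
       eq_equivalence.

Definition is_autom (N : grp) (f : N -> N) : Prop :=
  (forall x y, geq x y -> geq (f x) (f y)) /\
  (forall x y, geq (f (gmul x y)) (gmul (f x) (f y))) /\
  exists g : N -> N,
    (forall x y, geq x y -> geq (g x) (g y)) /\
    (forall x, geq (g (f x)) x) /\ (forall x, geq (f (g x)) x).

Definition is_gaction (N H : grp) (phi : H -> N -> N) : Prop :=
  (forall h, is_autom (phi h)) /\
  (forall h h', geq h h' -> forall x, geq (phi h x) (phi h' x)) /\
  (forall h1 h2 x, geq (phi (gmul h1 h2) x) (phi h1 (phi h2 x))).

Section Semidirect.
Variables (N H : grp) (phi : H -> N -> N).

Definition sd_eq (p q : N * H) : Prop := geq p.1 q.1 /\ geq p.2 q.2.

Lemma sd_eq_equiv : Equivalence sd_eq.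
Proof.
split.
- by move=> p; split; apply: geq_refl.
- by move=> p q [H1 H2]; split; apply: geq_sym.
- by move=> p q r [H1 H2] [H3 H4]; split; [apply: geq_trans H3|apply: geq_trans H4].
Qed.

Definition semidir : grp :=
  @Grp (N * H)%type sd_eq
    (fun p q => (gmul p.1 (phi p.2 q.1), gmul p.2 q.2))
    (fun p => (phi (ginv p.2) (ginv p.1), ginv p.2))
    (gone, gone) sd_eq_equiv.
End Semidirect.

(* Main.v *)
(* L_{m+2} is the semidirect product of the free product of m copies of Z/3,
   with generators a_0, ..., a_{m-1}, by the group of order 2 generated by an
   element t inverting all the a_i: y_j corresponds to g_j t g_j^-1 with
   g_j = a_0 ... a_{j-1}.  In terms of reduced words, every involution is
   conjugate to t, so an injective endomorphism fixes t up to conjugation; then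
   it maps a_i to a reduced word which is a palindrome of order 3, hence a single
   letter.  Thus Aut(L_{m+2}) consists of the conjugations composed with the
   signed permutations of the a_i, the only overlap being the conjugation by t,
   which changes all signs. *)
From Stdlib Require Import Setoid Morphisms IndefiniteDescription.
From HB Require Import structures.
From mathcomp Require Import all_boot all_fingroup.
Require Import Defs.
Set Implicit Arguments. Unset Strict Implicit. Unset Printing Implicit Defensive.

(** Peel off the first and last letters together: each is the image of the other by [f], so a middle
    letter is fixed by [f]. Used with the identity for palindromes, and with [negl], which fixes no
    letter, for words equal to their inverse. *)
Lemma map_rev_split (T : Type) (f : T -> T) (w : seq T) :
    w = map f (rev w) ->
  exists u, w = u ++ map f (rev u) \/
            exists2 c, f c = c & w = u ++ c :: map f (rev u).
Proof.
have [n] := ubnP (size w); elim: n w => // n IHn [|l w] sz.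
  by exists [::]; left.
case/lastP: w sz => [_ [fl]|v b]; first by exists [::]; right; exists l.
rewrite /= size_rcons rev_cons rev_rcons /= map_rcons => sz [lE vE].
have [vE' bE] := rcons_inj vE.
have [u [{}vE|[c fc {}vE]]] := IHn v (ltnW sz) vE'.
  exists (l :: u); left; rewrite {1}vE rev_cons map_rcons {1}bE /=.
  by rewrite -!cats1 catA.
exists (l :: u); right; exists c => //.
by rewrite {1}vE rev_cons map_rcons {1}bE /= -!cats1 -catA.
Qed.

(** * Reduced words *)

Section ReducedWords.
Variable I : choiceType.
Implicit Types (l : I * bool) (u v w x : seq (I * bool)) (s : I -> I).
Implicit Types (d : I -> bool).

(* The letter (i, false) stands for a generator a_i of order 3 and (i, true)
   for its inverse a_i^2. *)
Definition negl l := (l.1, ~~ l.2).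

Definition reduced w := sorted (fun l l' => l.1 != l'.1) w.

(** Left multiplication by a letter: two equal letters merge into the inverse one because a_i^2 =
    a_i^-1. One step suffices, since the next letter of a reduced word has another index. *)
Definition push l w :=
  if w is l' :: w' then
    if l.1 == l'.1 then if l.2 == l'.2 then negl l :: w' else w' else l :: w
  else [:: l].

Definition wmul w x := foldr push x w.

Definition winv w := map negl (rev w).

Definition sletter s d l := (s l.1, l.2 (+) d l.1).

Definition flip (e : bool) : seq (I * bool) -> seq (I * bool) :=
  map (sletter id (fun=> e)).

Lemma neglK : involutive negl.
Proof. by case=> i b; rewrite /negl /= negbK. Qed.

Lemma reduced_behead l w : reduced (l :: w) -> reduced w.
Proof. by case: w => //= l' w /andP[]. Qed.

Lemma push_reduced_cons l w : reduced (l :: w) -> push l w = l :: w.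
Proof. by case: w => //= l' w /andP[/negPf-> _]. Qed.

Lemma reduced_push l w : reduced w -> reduced (push l w).
Proof.
case: l => i b; case: w => //= -[j c] w rw /=.
have [->|ne] := eqVneq i j; last by rewrite /= ne.
by have [->|_] := eqVneq b c; [case: w rw | apply: reduced_behead rw].
Qed.

(** Van der Waerden's method: the letters act on reduced words with a_i a_i = a_i^-1 and a_i^-1
    inverse to a_i. Associativity of [wmul] is then read off from this action, without confluence of
    rewriting. *)
Lemma push_push l w : reduced w -> push l (push l w) = push (negl l) w.
Proof.
case: l => i b; case: w => [_|[j c] w rw] /=; first by rewrite !eqxx.
have [ij|_] := eqVneq i j; last by rewrite /= !eqxx.
rewrite -{j}ij in rw *; have [bc|nbc] := eqVneq b c.
  by rewrite -{c}bc in rw *; rewrite /= eqxx; case: (b).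
have -> : ~~ b = c by move: nbc; case: (b); case: (c).
by rewrite !eqxx (neglK (i, b)) push_reduced_cons //; case: (w) rw.
Qed.

Lemma push_negl l w : reduced w -> push (negl l) (push l w) = w.
Proof.
case: l => i b; case: w => [_|[j c] w rw] /=; first by rewrite eqxx; case: b.
have [ij|_] := eqVneq i j; last by rewrite /= eqxx; case: b.
rewrite -{j}ij in rw *; have [bc|nbc] := eqVneq b c.
  by rewrite -{c}bc in rw *; rewrite /= !eqxx /negl /= negbK.
rewrite push_reduced_cons /negl /=; last by case: (w) rw.
by congr ((i, _) :: w); move: nbc; case: (b); case: (c).
Qed.

Lemma push_neglK l w : reduced w -> push l (push (negl l) w) = w.
Proof. by move=> rw; rewrite -{1}[l]neglK push_negl. Qed.

Lemma reduced_wmul w x : reduced x -> reduced (wmul w x).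
Proof. by move=> rx; elim: w => //= l w; apply: reduced_push. Qed.

Lemma wmul_push l w x : reduced x -> wmul (push l w) x = push l (wmul w x).
Proof.
move=> rx; case: w => //= -[j c] w; case: l => i b /=.
have rwx := reduced_wmul w rx.
case: (eqVneq i j) => [<-|//].
have [->|nbc] := eqVneq b c; first by rewrite /= push_push.
have -> : c = ~~ b by move: nbc; case: (b); case: (c).
by rewrite (push_neglK (i, b)).
Qed.

Lemma wmul_wmul w v x :
  reduced x -> wmul (wmul w v) x = wmul w (wmul v x).
Proof.
move=> rx; elim: w => //= l w IHw.
by rewrite wmul_push // IHw.
Qed.

Lemma wmul_cat w v x : wmul (w ++ v) x = wmul w (wmul v x).
Proof. exact: foldr_cat. Qed.

Lemma reduced_catr w v : reduced (w ++ v) -> reduced v.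
Proof. by elim: w => //= l w IHw /reduced_behead. Qed.

Lemma reduced_catl w v : reduced (w ++ v) -> reduced w.
Proof. by rewrite /reduced; case: w => //= l w; rewrite cat_path => /andP[]. Qed.

Lemma wmul_reduced w v : reduced (w ++ v) -> wmul w v = w ++ v.
Proof.
elim: w => //= l w IHw rw.
by rewrite IHw ?push_reduced_cons //; apply: reduced_behead rw.
Qed.

Lemma winv_cons l w : winv (l :: w) = winv w ++ [:: negl l].
Proof. by rewrite /winv rev_cons map_rcons cats1. Qed.

Lemma wmulKw w x : reduced x -> wmul (winv w) (wmul w x) = x.
Proof.
elim: w x => //= l w IHw x rx.
by rewrite winv_cons wmul_cat /= push_negl ?IHw // reduced_wmul.
Qed.

Lemma wmulVw w : reduced w -> wmul (winv w) w = [::].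
Proof.
by move=> rw; rewrite -[X in wmul _ X]cats0 -wmul_reduced ?cats0 // wmulKw.
Qed.

Lemma winvK : involutive winv.
Proof.
by move=> w; rewrite /winv -map_rev revK -map_comp map_id_in // => l _ /=; rewrite neglK.
Qed.

Lemma winv_rev w : winv w = flip true (rev w).
Proof. by rewrite /winv /flip; apply: eq_map => -[i b]; rewrite /sletter /= addbT. Qed.

Lemma reduced_rev w : reduced (rev w) = reduced w.
Proof. by rewrite /reduced rev_sorted; apply: eq_sorted => l l'; rewrite eq_sym. Qed.

Lemma reduced_map s d w :
  injective s -> reduced (map (sletter s d) w) = reduced w.
Proof.
move=> si; rewrite /reduced sorted_map; apply: eq_sorted => l l' /=.
by rewrite (inj_eq si).
Qed.

(** Injectivity of [s] preserves the test for equal indices, and adding the same sign to both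
    letters preserves the test for equal signs, so the same cancellations occur. *)
Lemma map_push s d l w : injective s ->
  map (sletter s d) (push l w) = push (sletter s d l) (map (sletter s d) w).
Proof.
move=> si; case: w => //= -[j c] w; case: l => i b /=.
rewrite (inj_eq si); case: eqP => [->|//].
rewrite (inj_eq (@addIb _)); case: eqP => //= _.
by rewrite /sletter /negl /= addNb.
Qed.

Lemma map_wmul s d w x : injective s ->
  map (sletter s d) (wmul w x) =
  wmul (map (sletter s d) w) (map (sletter s d) x).
Proof. by move=> si; elim: w => //= l w <-; rewrite map_push. Qed.

Lemma flip_wmul e w x : flip e (wmul w x) = wmul (flip e w) (flip e x).
Proof. exact: map_wmul. Qed.

Lemma flip_flip e f w : flip e (flip f w) = flip (e (+) f) w.
Proof.
rewrite /flip -map_comp; apply: eq_map => -[i b].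
by rewrite /sletter /= -addbA (addbC f).
Qed.

Lemma flip0 w : flip false w = w.
Proof. by rewrite /flip map_id_in // => -[i b] _; rewrite /sletter /= addbF. Qed.

Lemma reduced_flip e w : reduced (flip e w) = reduced w.
Proof. exact: reduced_map. Qed.

Lemma reduced_winv w : reduced (winv w) = reduced w.
Proof. by rewrite winv_rev reduced_flip reduced_rev. Qed.

Lemma flip_winv e w : flip e (winv w) = winv (flip e w).
Proof. by rewrite !winv_rev -map_rev !flip_flip addbC. Qed.

End ReducedWords.

(* (w, e) stands for w t^e in the semidirect product of the free product of
   copies of Z/3 indexed by I with the group of order 2 generated by t, which
   inverts every a_i. *)
Definition twisted (I : choiceType) : Type :=
  ({w : seq (I * bool) | reduced w} * bool)%type.

HB.instance Definition _ (I : choiceType) := Choice.on (twisted I).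

(** * The twisted group, its involutions and its elements of order 3 inverted by t *)

Section TwistedGroup.
Variable I : choiceType.
Implicit Types (x y z : twisted I) (l : I * bool) (u v w : seq (I * bool)).

Definition tw (w : seq (I * bool)) (rw : reduced w) (e : bool) : twisted I :=
  (exist _ w rw, e).

Definition tword x : seq (I * bool) := val x.1.
Definition tsign x : bool := x.2.

Lemma tword_reduced x : reduced (tword x).
Proof. exact: valP x.1. Qed.

Lemma tw_inj x y : tword x = tword y -> tsign x = tsign y -> x = y.
Proof. by case: x y => [w e] [v f] /val_inj /= <- /= <-. Qed.

Fact tone_proof : reduced ([::] : seq (I * bool)). Proof. by []. Qed.
Definition tone := tw tone_proof false.

Fact tmul_proof x y : reduced (wmul (tword x) (flip (tsign x) (tword y))).
Proof. by rewrite reduced_wmul // reduced_flip tword_reduced. Qed.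
Definition tmul x y := tw (tmul_proof x y) (tsign x (+) tsign y).

Fact tinv_proof x : reduced (flip (tsign x) (winv (tword x))).
Proof. by rewrite reduced_flip reduced_winv tword_reduced. Qed.
Definition tinv x := tw (tinv_proof x) (tsign x).

Lemma tmulA : associative tmul.
Proof.
move=> x y z; apply: tw_inj; last exact: addbA.
rewrite /tmul /tword /tsign /= flip_wmul flip_flip wmul_wmul //.
by rewrite reduced_flip; apply: tword_reduced.
Qed.

Lemma tmul1 : left_id tone tmul.
Proof. by move=> x; apply: tw_inj => //; rewrite /tword /= flip0. Qed.

Lemma tmulr1 : right_id tone tmul.
Proof.
move=> x; apply: tw_inj; last by rewrite /tsign /= addbF.
by rewrite /tword /= wmul_reduced ?cats0 //; apply: tword_reduced.
Qed.

Lemma tmulV : left_inverse tone tinv tmul.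
Proof.
move=> x; apply: tw_inj; last by rewrite /tsign /= addbb.
rewrite -[LHS]/(wmul (flip (tsign x) (winv (tword x)))
                      (flip (tsign x) (tword x))) flip_winv wmulVw //.
by rewrite reduced_flip tword_reduced.
Qed.

Lemma tinvK : involutive tinv.
Proof.
move=> x; apply: tw_inj => //.
rewrite -[LHS]/(flip (tsign x) (winv (flip (tsign x) (winv (tword x))))).
by rewrite flip_winv flip_flip addbb flip0 winvK.
Qed.

Lemma tmulrV : right_inverse tone tinv tmul.
Proof. by move=> x; rewrite -{1}[x]tinvK tmulV. Qed.

HB.instance Definition _ :=
  isGroup.Build (twisted I) tmulA tmul1 tmulr1 tmulV tmulrV.

Local Open Scope group_scope.

Definition letter (i : I) (b : bool) : twisted I :=
  @tw [:: (i, b)] isT false.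

Definition tflip : twisted I := tw tone_proof true.

Lemma tsignM x y : tsign (x * y) = tsign x (+) tsign y. Proof. by []. Qed.

Lemma twordM x y :
  tword (x * y) = wmul (tword x) (flip (tsign x) (tword y)).
Proof. by []. Qed.

Lemma twordV x : tword x^-1 = flip (tsign x) (winv (tword x)).
Proof. by []. Qed.

Lemma tflip2 : tflip * tflip = 1.
Proof. exact: tw_inj. Qed.

Lemma tflipV : tflip^-1 = tflip.
Proof. exact: tw_inj. Qed.

Lemma letter_inj i b j c : letter i b = letter j c -> i = j /\ b = c.
Proof. by move/(congr1 tword) => [-> ->]. Qed.

Lemma letterV i b : (letter i b)^-1 = letter i (~~ b).
Proof. by apply: tw_inj => //; rewrite twordV flip0. Qed.

Lemma letter_sqr i b : letter i b * letter i b = letter i (~~ b).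
Proof. by apply: tw_inj => //; rewrite twordM /= !eqxx addbF eqxx. Qed.

Lemma tflip_letter i b : tflip * letter i b * tflip^-1 = letter i (~~ b).
Proof. by apply: tw_inj => //; rewrite !twordM /= /sletter /= addbT. Qed.

Lemma tw_cons l w (rlw : reduced (l :: w)) (rw : reduced w) e :
  tw rlw e = letter l.1 l.2 * tw rw e.
Proof.
apply: tw_inj => //; rewrite twordM flip0.
by rewrite -[LHS](@wmul_reduced _ [:: l] w) //; case: l rlw.
Qed.

(** The a_i and t generate: a_i^-1 is the square of a_i, and a reduced word is the product of its
    letters. *)
Lemma twisted_hom_ext (G : groupType) (f g : twisted I -> G) :
    {morph f : x y / x * y} -> {morph g : x y / x * y} ->
    (forall i, f (letter i false) = g (letter i false)) ->
  f tflip = g tflip -> f =1 g.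
Proof.
move=> fM gM fga fgt.
have f1 (h : twisted I -> G) : {morph h : x y / x * y} -> h 1 = 1.
  by move=> hM; apply: (@mulgI _ (h 1)); rewrite -hM !mulg1.
have fgl i b : f (letter i b) = g (letter i b).
  by case: b => //; rewrite -(letter_sqr i false) fM gM fga.
case=> -[w rw] e; rewrite -[(_, _)]/(tw rw e).
elim: w rw => [|l w IHw] rw; last first.
  by rewrite (tw_cons _ (reduced_behead rw)) fM gM IHw fgl.
case: e; first by rewrite [tw _ _](_ : _ = tflip) //; apply: tw_inj.
by rewrite [tw _ _](_ : _ = 1) ?f1 //; apply: tw_inj.
Qed.

(** Commuting with t makes the word equal to its own sign change, which already fails at the first
    letter of a nonempty word. *)
Lemma cent_tflip x : x * tflip = tflip * x -> x = 1 \/ x = tflip.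
Proof.
move/(congr1 tword); rewrite !twordM /=.
case: x => -[w rw] e /=; rewrite /tword /=.
case: w rw => [|[i b] w] rw.
  by move=> _; case: e; [right | left]; apply: tw_inj.
rewrite wmul_reduced ?cats0 // => -[].
by move=> bE; exfalso; move: bE; case: (b).
Qed.

Lemma reduced_cat_adjacent u l l' v : reduced (u ++ l :: l' :: v) -> l.1 != l'.1.
Proof. by move/reduced_catr => /andP[]. Qed.

(** A nonempty palindrome of even length has two equal letters in the middle, so it is not
    reduced. *)
Lemma reduced_palindrome w : reduced w -> w = rev w ->
  w = [::] \/ exists u c, w = u ++ c :: rev u.
Proof.
move=> rw wE.
have [u] := @map_rev_split _ id w (etrans wE (esym (map_id _))).
rewrite map_id => -[{}wE|[c _ {}wE]]; last by right; exists u, c.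
case/lastP: u wE => [|u l] wE; first by left.
move: rw; rewrite wE rev_rcons cat_rcons => /reduced_cat_adjacent.
by rewrite eqxx.
Qed.

(** The word equals its inverse. No letter is its own inverse, so there is no middle letter; two
    mutually inverse letters meeting in the middle would contradict reducedness. *)
Lemma involution_even x : tsign x = false -> x * x = 1 -> x = 1.
Proof.
move=> sx /mulg1_eq /(congr1 tword).
rewrite twordV sx flip0 => /esym wE.
apply: tw_inj => //; have rw := tword_reduced x.
have [u [{}wE|[c]]] := map_rev_split wE; last first.
  by case: c => i b [] /=; case: b.
case/lastP: u wE => [//|u l] wE.
move: rw; rewrite wE rev_rcons cat_rcons => /reduced_cat_adjacent.
by rewrite eqxx.
Qed.

Lemma flip_winv_rev w : flip true (winv w) = rev w.
Proof. by rewrite winv_rev flip_flip flip0. Qed.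

(* The middle letter of a palindrome is the square of its inverse, so the
   palindrome u c u^r is g (t g t)^-1 with g = u c^-1. *)
Lemma involution_odd x :
  tsign x = true -> x * x = 1 -> exists g, x = g * tflip * g^-1.
Proof.
move=> sx /mulg1_eq /(congr1 tword).
rewrite twordV sx flip_winv_rev => /esym wE.
have rw := tword_reduced x.
have [w0|[u [c {}wE]]] := reduced_palindrome rw wE.
  by exists 1; rewrite invg1 mulg1 mul1g; apply: tw_inj.
have rg : reduced (u ++ [:: negl c]).
  move: rw; rewrite wE -cat_rcons => /reduced_catl.
  rewrite -cats1; case: (u) => //= l v.
  by rewrite /reduced /= !cat_path /=.
exists (tw rg false); rewrite -mulgA; apply: tw_inj => //.
rewrite -[RHS]/(wmul (u ++ [:: negl c])
  (flip false (flip true (flip false (winv (u ++ [:: negl c])))))).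
rewrite !flip0 flip_winv_rev rev_cat cats1 -cats1 wmul_cat wE.
rewrite [RHS](_ : _ = wmul u (push (negl c) (negl c :: rev u))) //.
rewrite /= !eqxx neglK wmul_reduced //.
by rewrite -wE.
Qed.

(* A reduced palindrome of length at least 2 starts and ends with the same
   letter, so squaring it merges only the two middle letters and yields a
   longer word. *)
Lemma torsion_letter x :
    tflip * x * tflip^-1 = x^-1 -> x * x * x = 1 -> x != 1 ->
  exists l, x = letter l.1 l.2.
Proof.
move=> xt x3 xn1.
have sx : tsign x = false.
  by move/(congr1 tsign): x3; rewrite !tsignM; case: (tsign x).
have wE : tword x = rev (tword x).
  move/(congr1 tword): xt.
  rewrite -mulgA -[LHS]/(flip true (tword (x * tflip^-1))).
  rewrite twordV sx flip0 twordM sx flip0.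
  rewrite -[X in wmul _ X]/([::]) wmul_reduced ?cats0 ?tword_reduced //=.
  move/(congr1 (flip true)).
  by rewrite flip_flip flip0 flip_winv_rev.
have rw := tword_reduced x.
have [w0|[[|l u] [c {}wE]]] := reduced_palindrome rw wE.
- by case/eqP: xn1; apply: tw_inj.
- by exists c; apply: tw_inj; rewrite // wE; case: c {wE}.
move: rw; rewrite wE => rw.
have x2 : x * x = x^-1 by rewrite -{3}(mulg1_eq x3) invgK.
move/(congr1 (size \o tword)): x2 => /=; rewrite twordV sx flip0.
set v := u ++ c :: rev u.
have {}wE : tword x = l :: v ++ [:: l].
  by rewrite wE rev_cons -cats1 /v -!catA.
have rlv : reduced ((l :: v) ++ [:: l]) by rewrite -[(l :: v) ++ _]wE tword_reduced.
rewrite twordM sx flip0 /winv size_map size_rev wE.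
rewrite -{1}[l :: v ++ _]/((l :: v) ++ [:: l]) wmul_cat.
rewrite [wmul [:: l] _]/= !eqxx wmul_reduced; last first.
  move: rlv; rewrite /reduced; case: (v) => [|l' v'] /=; first by rewrite eqxx.
  rewrite !cat_path /= !andbT => /andP[lv /andP[pv ll]].
  by rewrite lv pv ll /= cat_path /= pv ll.
rewrite size_cat -[size (negl l :: _)]/(size (l :: v ++ [:: l])) => /eqP.
by rewrite -[X in _ == X]add0n eqn_add2r.
Qed.

End TwistedGroup.

(** * Signed permutations of the letters and injective endomorphisms *)

Section SignedPermutations.
Variable I : finType.
Local Open Scope group_scope.
Implicit Types (x y : twisted I) (d : I -> bool) (s : {perm I}).

(* perm composition is from left to right: letters are moved by s^-1 to get a
   left action. *)
Definition sperm_letter d s (l : I * bool) :=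
  sletter (s^-1)%g (d \o (s^-1)%g) l.

Fact sperm_proof d s x : reduced (map (sperm_letter d s) (tword x)).
Proof. by rewrite reduced_map ?tword_reduced //; apply: perm_inj. Qed.

Definition sperm d s x : twisted I := tw (sperm_proof d s x) (tsign x).

Lemma tword_sperm d s x : tword (sperm d s x) = map (sperm_letter d s) (tword x).
Proof. by []. Qed.

Lemma spermM d s : {morph sperm d s : x y / x * y}.
Proof.
move=> x y; apply: tw_inj => //.
rewrite twordM !tword_sperm twordM map_wmul; last exact: perm_inj.
congr wmul; rewrite /flip -!map_comp; apply: eq_map => -[i b] /=.
by rewrite /sperm_letter /sletter /= addbAC.
Qed.

Lemma sperm_tflip d s : sperm d s (tflip I) = tflip I.
Proof. exact: tw_inj. Qed.

Lemma sperm_letterE d s i b :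
  sperm d s (letter (s i) b) = letter i (b (+) d i).
Proof.
by apply: tw_inj; rewrite // tword_sperm /= /sperm_letter /sletter /= permK.
Qed.

(** The letter of index [s' (s i)] goes to [s i] with sign [d' (s i)], then to [i] with sign
    [d i]. *)
Lemma sperm_comp d s d' s' x :
  sperm d s (sperm d' s' x) = sperm (fun i => d i (+) d' (s i)) (s * s') x.
Proof.
apply: tw_inj => //; rewrite !tword_sperm -map_comp; apply: eq_map => -[i b].
rewrite /sperm_letter /sletter /= invMg !permM permKV.
by rewrite -addbA [d _ (+) _]addbC.
Qed.

Lemma eq_sperm d d' s x : d =1 d' -> sperm d s x = sperm d' s x.
Proof.
move=> dd; apply: tw_inj => //; rewrite !tword_sperm; apply: eq_map => -[i b].
by rewrite /sperm_letter /sletter /= dd.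
Qed.

Lemma sperm_id x : sperm xpred0 1 x = x.
Proof.
apply: tw_inj => //; rewrite tword_sperm map_id_in // => -[i b] _.
by rewrite /sperm_letter /sletter /= invg1 perm1 addbF.
Qed.

Lemma sperm_compl d s x :
  sperm (fun i => ~~ d i) s x = tflip I * sperm d s x * (tflip I)^-1.
Proof.
move: x; apply: twisted_hom_ext => [||i|].
- exact: spermM.
- by move=> x y; rewrite spermM !mulgA mulgVK.
- rewrite -[i](permKV s) !sperm_letterE.
  by rewrite tflip_letter.
- by rewrite !sperm_tflip mulgK.
Qed.

Lemma sperm_compl_if (b : bool) d s x :
  sperm (fun i => d i (+) b) s x =
  (if b then tflip I else 1) * sperm d s x * (if b then tflip I else 1)^-1.
Proof.
case: b; last first.
  by rewrite mul1g invg1 mulg1; apply: eq_sperm => i; rewrite addbF.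
by rewrite -sperm_compl; apply: eq_sperm => i; rewrite addbT.
Qed.

Lemma sperm_inj d s d' s' : sperm d s =1 sperm d' s' -> s = s' /\ d =1 d'.
Proof.
move=> e; have {}e i : (s'^-1 (s i) = i)%g /\ d i = d' i.
  have := e (letter (s i) false); rewrite sperm_letterE.
  rewrite -[s i](permKV s') sperm_letterE permKV => /letter_inj[iE].
  by rewrite -iE.
split=> [|i]; last by case: (e i).
by apply/permP => i; apply: (@perm_inj _ s'^-1); rewrite permK; case: (e i).
Qed.

(** Both signed permutations fix t, so evaluation at t puts [x] in the centralizer of t, which is
    {1, t}; conjugation by t changes all signs. *)
Lemma conj_sperm_inj x d s d' s' :
    (forall y, x * sperm d s y * x^-1 = sperm d' s' y) ->
  s = s' /\ (x = 1 /\ d =1 d' \/ x = tflip I /\ d =1 (fun i => ~~ d' i)).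
Proof.
move=> e; have := e (tflip I); rewrite !sperm_tflip.
move/(canRL (mulgVK _)) => /cent_tflip[]xE; rewrite {x}xE in e *.
  have [-> dd] : s = s' /\ d =1 d'.
    by apply: sperm_inj => y; rewrite -e mul1g invg1 mulg1.
  by split; [|left].
have [-> dd] : s = s' /\ (fun i => ~~ d i) =1 d'.
  by apply: sperm_inj => y; rewrite sperm_compl e.
by split; [|right; split=> // i; rewrite -dd negbK].
Qed.

(* Up to conjugation an injective endomorphism fixes t; it then maps each a_i
   to an element of order 3 inverted by t, that is, to a single letter. *)
Lemma twisted_injective_endo (f : twisted I -> twisted I) :
    {morph f : x y / x * y} -> injective f ->
  exists x d s, forall y, f y = x * sperm d s y * x^-1.
Proof.
move=> fM fi.
have f1 : f 1 = 1 by apply: (@mulgI _ (f 1)); rewrite -fM !mulg1.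
have ft2 : f (tflip I) * f (tflip I) = 1 by rewrite -fM tflip2 f1.
(* An involution of even sign is trivial, so by injectivity the image of t has odd sign. *)
have [g ftE] : exists g, f (tflip I) = g * tflip I * g^-1.
  apply: involution_odd => //; apply/negPn/negP => /negbTE sft.
  have := involution_even sft ft2; rewrite -f1 => /fi.
  by move/(congr1 (@tsign _)).
pose h y := g^-1 * f y * g.
have hM : {morph h : x y / x * y}.
  by move=> x y; rewrite /h fM !mulgA mulgK.
have hi : injective h by move=> x y /mulIg /mulgI /fi.
have ht : h (tflip I) = tflip I by rewrite /h ftE -!mulgA mulVg mulg1 mulKg.
have h1 : h 1 = 1 by rewrite /h f1 mulg1 mulVg.
have hV y : h y^-1 = (h y)^-1 by apply/esym/mulg1_eq; rewrite -hM mulgV.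
have hl i : exists l, h (letter i false) = letter l.1 l.2.
  apply: torsion_letter.
  - by rewrite -{1 2}ht -!hV -!hM tflip_letter letterV.
  - by rewrite -!hM letter_sqr -letterV mulVg.
  - by rewrite -h1 (inj_eq hi); apply/eqP => /(congr1 (@tword _)).
have [F FE] := fin_all_exists hl.
(* If a_i and a_j had images of the same index, then the image of a_i would be that of a_j or of
   a_j^-1. *)
have Fi : injective (fun i => (F i).1).
  move=> i j Fij; have [bE|nbE] := eqVneq (F i).2 (F j).2.
    have /hi /letter_inj[//] : h (letter i false) = h (letter j false).
    by rewrite !FE Fij bE.
  have /hi /letter_inj[//] : h (letter i false) = h (letter j true).
  rewrite -(letterV j false) hV !FE letterV Fij; congr letter.
  by move: nbE; case: (F i).2; case: (F j).2.
(* [sperm d s] sends the index [s i] to [i] and reads its sign at the target [i]: hence the inverse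
   permutation, and the sign of [F] at the preimage of [k]. *)
exists g, (fun k => (F ((perm Fi)^-1 k)).2), (perm Fi)^-1 => y.
rewrite -[f y](_ : g * h y * g^-1 = _); last by rewrite /h !mulgA mulgV mul1g mulgK.
congr (_ * _ * _); move: y; apply: twisted_hom_ext => // [|i|].
- exact: spermM.
- rewrite FE -[i in RHS](permK (perm Fi)) sperm_letterE permK permE.
  by [].
- by rewrite ht sperm_tflip.
Qed.

End SignedPermutations.

(** * The isomorphism with L_(m+2) *)

(* ln_rel for n = m + 2, at the simplified index type 'I_m.+1, so that setoid
   rewriting does not meet 'I_m.+2.-1. *)
Definition lneq (m : nat) : seq 'I_m.+1 -> seq 'I_m.+1 -> Prop := @ln_rel m.+2.

Section LnWords.
Variable m : nat.
Implicit Types (u v w p q : seq 'I_m.+1) (i j : 'I_m.+1).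
Local Notation "u =L v" := (@lneq m u v) (at level 70).

Lemma lneq_refl w : w =L w.
Proof. exact: ln_refl. Qed.

Lemma lneq_ctx p q u v : u =L v -> p ++ u ++ q =L p ++ v ++ q.
Proof.
elim=> {u v} [w|u v _|u v w _ IHu _|u v i|u v i j ij].
- exact: lneq_refl.
- exact: ln_sym.
- exact: ln_trans.
- by rewrite -!catA !(catA p u) /=; apply: (@ln_sq m.+2).
- by rewrite -!catA !(catA p u) /=; apply: (@ln_braid m.+2).
Qed.

#[global] Instance lneq_equivalence : Equivalence (@lneq m).
Proof. exact: (ln_rel_equiv m.+2). Qed.

#[global] Instance lneq_cat :
  Proper (@lneq m ==> @lneq m ==> @lneq m) (@cat 'I_m.+1).
Proof.
move=> u u' uu v v' vv; apply: (@ln_trans m.+2 _ (u' ++ v)).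
  exact: (lneq_ctx [::] v uu).
by have := lneq_ctx u' [::] vv; rewrite !cats0.
Qed.

#[global] Instance lneq_cons i : Proper (@lneq m ==> @lneq m) (cons i).
Proof. by move=> u v uv; apply: (@lneq_cat [:: i] [:: i]) => //; apply: lneq_refl. Qed.

Lemma lneq_sq i w : [:: i, i & w] =L w.
Proof. exact: (@ln_sq m.+2 [::] w i). Qed.

Lemma lneq_braid i j w :
  val j = (val i).+1 -> [:: i, j, i & w] =L [:: j, i, j & w].
Proof. exact: (@ln_braid m.+2 [::] w). Qed.

Lemma lneq_catV u w : u ++ rev u ++ w =L w.
Proof.
elim/last_ind: u w => [|u i IHu] w; first exact: lneq_refl.
by rewrite rev_rcons cat_rcons /= lneq_sq.
Qed.

Lemma lneq_catVr u w : rev u ++ u ++ w =L w.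
Proof. by rewrite -{2}[u]revK; apply: lneq_catV. Qed.

#[global] Instance lneq_rev : Proper (@lneq m ==> @lneq m) rev.
Proof.
move=> u v uv; rewrite -[rev u]cats0 -(lneq_catV v [::]) -{1}uv.
by rewrite lneq_catVr cats0; apply: lneq_refl.
Qed.

End LnWords.

#[local] Hint Resolve lneq_refl : core.

(** For involutions a and b the second hypothesis says that (ab)^3 = 1; then bab = (abab)b = aba. *)
Lemma braid_of_order3 (H : groupType) (a b : H) :
  (b * b = 1 -> a * b * (a * b) = b * a -> a * (b * a) = b * (a * b))%g.
Proof. by move=> b2 ab; rewrite [RHS]mulgA -[in RHS]ab -!mulgA b2 mulg1. Qed.

(** * Evaluation of words in the twisted group, and its inverse *)

Section LnTwisted.
Variable m : nat.
Local Open Scope group_scope.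
Implicit Types (w u v : seq 'I_m.+1) (x y : twisted 'I_m).
Local Notation G := (twisted 'I_m).
Local Notation t := (tflip 'I_m).
Local Notation "u =L v" := (@lneq m u v) (at level 70).

(** From index [m] on, the factor 1 is a default value; the generators only involve [k <= m]. *)
Fixpoint prefix_letters (k : nat) : G :=
  if k is k'.+1 then
    prefix_letters k' * (if insub k' is Some i then letter i false else 1)
  else 1.
Local Notation g := prefix_letters.

Definition ln_eval1 (i : 'I_m.+1) : G := g i * t * (g i)^-1.
Definition ln_eval w : G := foldr (fun i x => ln_eval1 i * x) 1 w.

(** A word h_k for g_k. Since y_k y_(k+1) = g_k a_k g_k^-1 (indices from 0), multiplying g_k by a_k
    on the right amounts to prefixing h_k with y_k y_(k+1). *)
Fixpoint prefix_word (k : nat) : seq 'I_m.+1 :=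
  if k is k'.+1 then [:: inord k', inord k & prefix_word k'] else [::].
Local Notation h := prefix_word.

Definition letter_word (l : 'I_m * bool) : seq 'I_m.+1 :=
  let a := rev (h l.1) ++ [:: inord l.1, inord l.1.+1 & h l.1] in
  if l.2 then rev a else a.
Definition letters_word (w : seq ('I_m * bool)) := flatten (map letter_word w).
Definition ln_word x : seq 'I_m.+1 := letters_word (tword x) ++ nseq (tsign x) ord0.

Lemma prefix_letters_ord (i : 'I_m) : g i.+1 = g i * letter i false.
Proof. by rewrite /= valK. Qed.

Lemma ln_eval_cat u v : ln_eval (u ++ v) = ln_eval u * ln_eval v.
Proof. by elim: u => [|i u IHu] /=; rewrite ?mul1g // IHu mulgA. Qed.

Lemma ln_eval1_sqr i : ln_eval1 i * ln_eval1 i = 1.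
Proof.
by rewrite /ln_eval1 !mulgA mulgVK -[_ * t * t]mulgA tflip2 mulg1 mulgV.
Qed.

Lemma ln_eval1V i : (ln_eval1 i)^-1 = ln_eval1 i.
Proof. exact/mulg1_eq/ln_eval1_sqr. Qed.

Lemma ln_eval_rev w : ln_eval (rev w) = (ln_eval w)^-1.
Proof.
elim: w => [|i w IHw]; first by rewrite /= invg1.
by rewrite rev_cons -cats1 ln_eval_cat IHw /= mulg1 invgM ln_eval1V.
Qed.

(** With g = g_i and a = a_i, the product is g t a t a^-1 g^-1 = g a^-2 g^-1 = g a g^-1. *)
Lemma ln_eval1_succ (i : 'I_m) (j j' : 'I_m.+1) :
    val j = i -> val j' = i.+1 ->
  ln_eval1 j * ln_eval1 j' = g i * letter i false * (g i)^-1.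
Proof.
rewrite /ln_eval1 => -> ->; rewrite prefix_letters_ord.
rewrite invgM !mulgA mulgVK -[g i * t * _]mulgA -[g i * (_ * _) * t]mulgA.
rewrite -{2}[t]tflipV tflip_letter letterV.
by rewrite -(mulgA (g i) (letter _ _)) letter_sqr.
Qed.

Lemma ln_eval1_braid (j j' : 'I_m.+1) : val j' = (val j).+1 ->
  ln_eval1 j * (ln_eval1 j' * ln_eval1 j) =
  ln_eval1 j' * (ln_eval1 j * ln_eval1 j').
Proof.
move=> jj'; have jm : val j < m by rewrite -ltnS -jj' ltn_ord.
have E := @ln_eval1_succ (Ordinal jm) j j' erefl jj'.
apply: braid_of_order3; first exact: ln_eval1_sqr.
rewrite -[RHS](_ : (ln_eval1 j * ln_eval1 j')^-1 = _).
  by rewrite E !invgM invgK letterV -letter_sqr !mulgA mulgVK.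
by rewrite invgM !ln_eval1V.
Qed.

Lemma ln_eval_rel w v : w =L v -> ln_eval w = ln_eval v.
Proof.
elim=> {w v} [|||u v i|u v i j ij] //.
- by move=> u v w _ -> _ ->.
- by rewrite !ln_eval_cat /= mulg1 ln_eval1_sqr mul1g.
rewrite !ln_eval_cat; congr (_ * (_ * _)).
by rewrite [LHS]/= [RHS]/= !mulg1; apply: ln_eval1_braid.
Qed.

Lemma ln_eval_prefix k : k <= m -> ln_eval (h k) = g k.
Proof.
elim: k => // k IHk km; rewrite /= IHk ?(ltnW km) // mulgA.
rewrite (@ln_eval1_succ (Ordinal km)) /= ?inordK //; last exact: ltnW.
by rewrite insubT mulgVK.
Qed.

Lemma ln_eval_letter l : ln_eval (letter_word l) = letter l.1 l.2.
Proof.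
case: l => i b; rewrite /letter_word.
set a := (X in if _ then rev X else X).
have aE : ln_eval a = letter i false.
  rewrite ln_eval_cat ln_eval_rev /= ln_eval_prefix ?(ltnW (ltn_ord i)) //.
  rewrite [_ * (_ * g i)]mulgA (@ln_eval1_succ i) /= ?inordK // ?ltnS //.
    by rewrite mulgVK mulKg.
  exact: ltnW.
by case: (b) => /=; rewrite ?ln_eval_rev aE ?letterV.
Qed.

Lemma ln_eval_word x : ln_eval (ln_word x) = x.
Proof.
case: x => -[w rw] e; rewrite -[(_, _)]/(tw rw e) /ln_word ln_eval_cat /tword /=.
elim: w rw => [|l w IHw] rw /=.
  case: e; rewrite /= mul1g; last exact: tw_inj.
  by rewrite /ln_eval1 /= mul1g invg1 !mulg1; apply: tw_inj.
rewrite ln_eval_cat ln_eval_letter -mulgA (IHw (reduced_behead rw)).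
exact/esym/tw_cons.
Qed.

(** The word form of y_k = g_k t g_k^-1, by induction: with a = y_k and b = y_(k+1), the braid
    relation and the squares reduce ababa to b. *)
Lemma prefix_word_conj k : k <= m ->
  h k ++ [:: ord0] ++ rev (h k) =L [:: inord k].
Proof.
elim: k => [_|k IHk km].
  have -> : inord 0 = ord0 :> 'I_m.+1 by apply: val_inj; rewrite /= inordK.
  exact: lneq_refl.
set a : 'I_m.+1 := inord k; set b : 'I_m.+1 := inord k.+1.
have ab : val b = (val a).+1 by rewrite /= !inordK // ltnS ltnW.
have -> : h k.+1 ++ [:: ord0] ++ rev (h k.+1) =
          [:: a; b] ++ (h k ++ [:: ord0] ++ rev (h k)) ++ [:: b; a].
  by rewrite /= -/a -/b !rev_cons -!cats1 -!catA.
rewrite (IHk (ltnW km)) -/a /= (@lneq_braid m a b) //.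
by rewrite lneq_sq lneq_sq.
Qed.

Lemma letter_word_inv l : letter_word (negl l) = rev (letter_word l).
Proof. by case: l => i []; rewrite /letter_word /= ?revK. Qed.

Lemma letter_word_sqr l v :
  letter_word l ++ letter_word l ++ v =L letter_word (negl l) ++ v.
Proof.
(* Once the inner h_i h_i^-1 has cancelled, this is abab = babb = ba for a = y_i and b = y_(i+1).
   The other sign follows by cancelling. *)
have pos i u : letter_word (i, false) ++ letter_word (i, false) ++ u =L
               letter_word (i, true) ++ u.
  rewrite /letter_word /=; set a : 'I_m.+1 := inord i.
  set b : 'I_m.+1 := inord i.+1.
  have ab : val b = (val a).+1 by rewrite /= !inordK ?ltnS // ltnW.
  rewrite rev_cat revK !rev_cons -!cats1 -!catA /= lneq_catV.
  by rewrite (@lneq_braid m a b) // lneq_sq.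
case: l => i []; last exact: pos.
rewrite -(pos i v) -[(i, true)]/(negl (i, false)) neglK letter_word_inv.
by rewrite lneq_catVr.
Qed.

Lemma letter_word_flip l v :
  ord0 :: letter_word l ++ v =L letter_word (negl l) ++ ord0 :: v.
Proof.
have pos i u : ord0 :: letter_word (i, false) ++ u =L
               letter_word (i, true) ++ ord0 :: u.
  rewrite /letter_word /=; set a : 'I_m.+1 := inord i.
  set b : 'I_m.+1 := inord i.+1.
  have hE p : h i ++ ord0 :: rev (h i) ++ p =L a :: p.
    have E := @prefix_word_conj i (ltnW (ltn_ord i)).
    rewrite -[h i ++ _]/(h i ++ ([:: ord0] ++ rev (h i)) ++ p) catA.
    by rewrite E.
  (* As h_i conjugates y_0 to y_i, moving y_0 across h_i^-1 or h_i turns it into y_i, which cancels;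
     both sides become h_i^-1 y_(i+1) h_i. *)
  have E1 p : ord0 :: rev (h i) ++ p =L rev (h i) ++ a :: p.
    by rewrite -hE lneq_catVr.
  have E2 p : h i ++ ord0 :: p =L a :: h i ++ p.
    by rewrite -hE lneq_catVr.
  rewrite rev_cat revK !rev_cons -!cats1 -!catA /= E1 E2.
  by rewrite !lneq_sq.
case: l => i []; last exact: pos.
have E := pos i (ord0 :: v); rewrite lneq_sq in E.
by rewrite -E lneq_sq.
Qed.

Lemma letters_word_push l (w : seq ('I_m * bool)) :
  letters_word (push l w) =L letter_word l ++ letters_word w.
Proof.
have E : letters_word (l :: w) = letter_word l ++ letters_word w by [].
case: l w E => i b [|[j c] w] E; rewrite /push; first by rewrite E.
rewrite /=; case: eqVneq => [ij|_]; last by rewrite E.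
rewrite -{}ij; have [bc|nbc] := eqVneq b c.
  rewrite -{}bc -[letters_word ((i, b) :: w)]/(letter_word (i, b) ++ letters_word w).
  by rewrite letter_word_sqr.
have -> : c = ~~ b by move: nbc; case: (b); case: (c).
rewrite -[letters_word ((i, _) :: w)]/(letter_word (negl (i, b)) ++ letters_word w).
by rewrite letter_word_inv lneq_catV.
Qed.

Lemma letters_word_wmul (w v : seq ('I_m * bool)) :
  letters_word (wmul w v) =L letters_word w ++ letters_word v.
Proof.
elim: w => [|l w IHw] /=; first exact: lneq_refl.
rewrite letters_word_push IHw -catA; exact: lneq_refl.
Qed.

Lemma letters_word_flip (e : bool) (w : seq ('I_m * bool)) v :
  nseq e ord0 ++ letters_word w ++ v =L letters_word (flip e w) ++ nseq e ord0 ++ v.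
Proof.
case: e => /=; last by rewrite flip0; apply: lneq_refl.
elim: w => [|[i b] w IHw] /=; first exact: lneq_refl.
rewrite /letters_word /= -/(letters_word w) -catA letter_word_flip IHw.
rewrite /sletter /= addbT -!catA; exact: lneq_refl.
Qed.

Lemma ln_wordM x y : ln_word (x * y) =L ln_word x ++ ln_word y.
Proof.
rewrite /ln_word twordM letters_word_wmul -!catA letters_word_flip.
have -> : nseq (tsign (x * y)) ord0 =L
          nseq (tsign x) ord0 ++ nseq (tsign y) (@ord0 m).
  rewrite tsignM; case: (tsign x); case: (tsign y) => /=; try exact: lneq_refl.
  by rewrite lneq_sq; apply: lneq_refl.
exact: lneq_refl.
Qed.

Lemma ln_word_prefix k : k <= m -> ln_word (g k) =L h k.
Proof.
elim: k => [_|k IHk km]; first exact: lneq_refl.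
rewrite ln_wordM (IHk (ltnW km)) insubT /ln_word /= /letters_word /= cats0.
by rewrite /letter_word /= -?catA /= lneq_catV cats0.
Qed.

Lemma ln_wordV x : ln_word x^-1 =L rev (ln_word x).
Proof.
rewrite -[ln_word x^-1]cats0 -(lneq_catV (ln_word x) [::]) catA -ln_wordM.
by rewrite mulVg cats0.
Qed.

Lemma ln_word_eval1 i : ln_word (ln_eval1 i) =L [:: i].
Proof.
rewrite /ln_eval1 !ln_wordM ln_wordV ln_word_prefix ?leq_ord // -catA.
by rewrite -[ln_word t]/[:: ord0] prefix_word_conj ?inord_val // leq_ord.
Qed.

Lemma ln_word_eval w : ln_word (ln_eval w) =L w.
Proof.
elim: w => [|i w IHw]; first exact: lneq_refl.
by rewrite /= ln_wordM ln_word_eval1 IHw.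
Qed.

End LnTwisted.

(** * Automorphisms of a setoid group modelled by a group *)

Section Model.
Variables (A : grp) (T : groupType) (ev : A -> T) (qu : T -> A).
Hypothesis evP : forall x y, geq x y <-> ev x = ev y.
Hypothesis evM : forall x y, ev (gmul x y) = (ev x * ev y)%g.
Hypothesis evV : forall x, ev (ginv x) = (ev x)^-1%g.
Hypothesis quK : cancel qu ev.
Local Open Scope group_scope.
Implicit Types (a b : auto A) (x y : A) (u v : T).

Lemma geq_ev x y : geq x y -> ev x = ev y.
Proof. by move/evP. Qed.

(** [qu] is only a section of [ev], not a morphism; the choice of representative is harmless because
    [af a] respects [geq]. *)
Definition model a u : T := ev (af a (qu u)).

Lemma modelE a x : ev (af a x) = model a (ev x).
Proof. by apply/evP/af_proper/evP; rewrite quK. Qed.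

Lemma modelM a : {morph model a : u v / u * v}.
Proof.
move=> u v; rewrite -{1}[u]quK -{1}[v]quK -evM -modelE -evM.
exact/geq_ev/af_hom.
Qed.

Lemma model_inj a : injective (model a).
Proof.
move=> u v /evP /(ag_proper a) E; rewrite -[u]quK -[v]quK; apply/evP.
exact: geq_trans (geq_sym (agf a _)) (geq_trans E (agf a _)).
Qed.

Lemma auto_eqP a b : auto_eq a b <-> model a =1 model b.
Proof.
split=> [ab u|ab x]; first exact/evP/ab.
by apply/evP; rewrite !modelE ab.
Qed.

Lemma model_mul a b u : model (auto_mul a b) u = model a (model b u).
Proof. exact: (modelE a (af b (qu u))). Qed.

Lemma auto_mul_proper a a' b b' :
  auto_eq a a' -> auto_eq b b' -> auto_eq (auto_mul a b) (auto_mul a' b').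
Proof.
move=> /auto_eqP aa /auto_eqP bb; apply/auto_eqP => u.
by rewrite !model_mul aa bb.
Qed.

Lemma inn_relP a b :
  inn_rel a b <-> exists v, forall u, model a u = v * model b u * v^-1.
Proof.
split=> [[x xP]|[v vP]].
  by exists (ev x) => u; rewrite /model (geq_ev (xP _)) !evM evV.
exists (qu v) => y; apply/evP; rewrite !evM evV quK !modelE; exact: vP.
Qed.

(** Differing by an inner automorphism is already an equivalence, so the closure adds no pair. *)
Lemma out_eqP a b :
  @geq (OutG A) a b <-> exists v, forall u, model a u = v * model b u * v^-1.
Proof.
split=> [|/inn_relP]; last exact: Relation_Operators.rst_step.
elim=> {a b} [a b /inn_relP //|a|a b _ [v vP]|a b c _ [v vP] _ [w wP]].
- by exists 1 => u; rewrite mul1g invg1 mulg1.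
- by exists v^-1 => u; rewrite vP invgK !mulgA mulVg mul1g mulgVK.
- by exists (v * w) => u; rewrite vP wP invgM !mulgA.
Qed.

Lemma out_mul_proper a a' b b' :
    @geq (OutG A) a a' -> @geq (OutG A) b b' ->
  @geq (OutG A) (auto_mul a b) (auto_mul a' b').
Proof.
move=> /out_eqP[v vP] /out_eqP[w wP]; apply/out_eqP.
have modelV u : model a' u^-1 = (model a' u)^-1.
  have model1 : model a' 1 = 1.
    by apply: (@mulgI _ (model a' 1)); rewrite -modelM !mulg1.
  by apply/esym/mulg1_eq; rewrite -modelM mulgV.
(* Pushing the conjugation by [w] through the morphism [model a'] turns it into conjugation by its
   image. *)
exists (v * model a' w) => u.
by rewrite !model_mul wP vP !modelM modelV invgM !mulgA.
Qed.

Section AutoOf.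
Variables f f' : T -> T.
Hypotheses (fM : {morph f : u v / u * v}) (fK : cancel f f') (f'K : cancel f' f).

Program Definition auto_of : auto A :=
  @Auto A (fun x => qu (f (ev x))) (fun x => qu (f' (ev x))) _ _ _ _ _ _.
Next Obligation. by apply/evP; rewrite (geq_ev H). Qed.
Next Obligation. by apply/evP; rewrite (geq_ev H). Qed.
Next Obligation. by apply/evP; rewrite !evM fM !quK. Qed.
Next Obligation.
apply/evP; rewrite !evM !quK; apply: (can_inj fK).
by rewrite fM !f'K.
Qed.
Next Obligation. by apply/evP; rewrite !quK fK. Qed.
Next Obligation. by apply/evP; rewrite !quK f'K. Qed.

Lemma model_auto_of : model auto_of =1 f.
Proof. by move=> u; rewrite /model /= !quK. Qed.
End AutoOf.

End Model.

(** * Building isomorphisms and actions of setoid groups *)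

(** The inverse of [E] is obtained by choice. Compatibility of the product of [B] with [geq] is
    assumed because a [grp] does not include it; it makes the inverse multiplicative. *)
Lemma iso_of_bijection (A B : grp) (E : A -> B) :
    (forall x y, geq x y -> geq (E x) (E y)) ->
    (forall x y, geq (E x) (E y) -> geq x y) ->
    (forall x y, geq (E (gmul x y)) (gmul (E x) (E y))) ->
    (forall b, exists x, geq (E x) b) ->
    (forall a a' b b' : B, geq a a' -> geq b b' -> geq (gmul a b) (gmul a' b')) ->
  iso B A.
Proof.
move=> EP Ei EM Es mulP.
pose F b := proj1_sig (constructive_indefinite_description _ (Es b)).
have FE b : geq (E (F b)) b.
  exact: proj2_sig (constructive_indefinite_description _ (Es b)).
exists F, E; split; [|split; [|split; [|split]]] => //.
- move=> b b' bb; apply: Ei; apply: (geq_trans (FE b)).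
  by apply: (geq_trans bb); apply: geq_sym.
- move=> b b'; apply: Ei; apply: (geq_trans (FE _)).
  by apply: geq_sym; apply: (geq_trans (EM _ _)); apply: mulP.
- by move=> x; apply: Ei.
Qed.

Lemma gaction_intro (N H : grp) (phi : H -> N -> N) :
    (forall h h' x x', geq h h' -> geq x x' -> geq (phi h x) (phi h' x')) ->
    (forall h x y, geq (phi h (gmul x y)) (gmul (phi h x) (phi h y))) ->
    (forall x, geq (phi gone x) x) ->
    (forall h h' x, geq (phi (gmul h h') x) (phi h (phi h' x))) ->
    (forall h : H, geq (gmul (ginv h) h) gone) ->
    (forall h : H, geq (gmul h (ginv h)) gone) ->
  is_gaction phi.
Proof.
move=> phiP phiM phi1 phiA mulVh mulhV.
split; last by split=> // h h' hh x; apply: phiP => //; apply: geq_refl.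
move=> h; split; first by move=> x y; apply: phiP; apply: geq_refl.
split; first exact: phiM.
exists (phi (ginv h)); split; first by move=> x y; apply: phiP; apply: geq_refl.
by split=> x; apply: geq_trans (phi1 x);
  apply: (geq_trans (geq_sym (phiA _ _ _))); apply: phiP => //; apply: geq_refl.
Qed.

(** * Normal form of the automorphisms *)

Section NormalForm.
Variable k : nat.
Local Open Scope group_scope.
Local Notation T := (twisted 'I_k.+1).
Local Notation t := (tflip 'I_k.+1).
Implicit Types (x y : T) (d : 'I_k.+1 -> bool) (e : {ffun 'I_k -> bool}).
Implicit Types (s : 'S_k.+1) (b : bool).

(* Flipping all signs is conjugation by t, so modulo inner automorphisms the
   sign of the letter ord0 may be taken to be trivial. *)
Definition ext e (i : 'I_k.+1) : bool :=
  if unlift ord0 i is Some j then e j else false.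

(** Sign functions modulo constants: [norm] is the projection and [ext] the section vanishing at
    [ord0]. *)
Definition norm d : {ffun 'I_k -> bool} :=
  [ffun j => d (lift ord0 j) (+) d ord0].

Definition tpow b : T := if b then t else 1.

(** Precomposition by [s] on sign functions modulo constants. *)
Definition sign_act s e : {ffun 'I_k -> bool} := norm (ext e \o s).

Definition csperm x d s y : T := x * sperm d s y * x^-1.

Lemma ext0 e : ext e ord0 = false.
Proof. by rewrite /ext unlift_none. Qed.

Lemma ext_norm d i : ext (norm d) i = d i (+) d ord0.
Proof.
rewrite /ext; case: unliftP => [j ->|->]; first by rewrite ffunE.
by rewrite addbb.
Qed.

Lemma norm_ext e : norm (ext e) = e.
Proof. by apply/ffunP => j; rewrite ffunE ext0 addbF /ext liftK. Qed.

Lemma eq_norm d d' : d =1 d' -> norm d = norm d'.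
Proof. by move=> dd; apply/ffunP => j; rewrite !ffunE !dd. Qed.

Lemma ext_inj e e' : ext e =1 ext e' -> e = e'.
Proof. by move=> /eq_norm; rewrite !norm_ext. Qed.

Lemma extD e e' i : ext [ffun j => e j (+) e' j] i = ext e i (+) ext e' i.
Proof. by rewrite /ext; case: unliftP => [j _|//]; rewrite ffunE. Qed.

Lemma ext_const0 i : ext [ffun=> false] i = false.
Proof. by rewrite /ext; case: unliftP => [j _|//]; rewrite ffunE. Qed.

Lemma ext_sign_act s e i : ext (sign_act s e) i = ext e (s i) (+) ext e (s ord0).
Proof. exact: ext_norm. Qed.

Lemma sign_act1 e : sign_act 1 e = e.
Proof. by rewrite -[RHS]norm_ext; apply: eq_norm => i /=; rewrite perm1. Qed.

Lemma sign_actM s s' e : sign_act (s * s') e = sign_act s (sign_act s' e).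
Proof.
apply: ext_inj => i; rewrite !ext_sign_act !permM.
by rewrite addbACA addbb addbF.
Qed.

Lemma sign_actD s e e' : sign_act s [ffun j => e j (+) e' j] =
  [ffun j => sign_act s e j (+) sign_act s e' j].
Proof.
by apply: ext_inj => i; rewrite extD !ext_sign_act !extD addbACA.
Qed.

Lemma tpowD b b' : tpow (b (+) b') = tpow b * tpow b'.
Proof. by case: b; case: b'; rewrite /= ?mul1g ?mulg1 ?tflip2. Qed.

Lemma sperm_tpow d s b : sperm d s (tpow b) = tpow b.
Proof. by case: b; rewrite ?sperm_tflip //; apply: tw_inj. Qed.

Lemma sperm_tpow_conj b d s y :
  tpow b * sperm d s y = sperm (fun i => d i (+) b) s y * tpow b.
Proof. by rewrite sperm_compl_if mulgVK. Qed.

Lemma spermV d s y : sperm d s y^-1 = (sperm d s y)^-1.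
Proof.
by apply/esym/mulg1_eq; rewrite -spermM mulgV; apply: (sperm_tpow d s false).
Qed.

Lemma cspermM x d s : {morph csperm x d s : y z / y * z}.
Proof. by move=> y z; rewrite /csperm spermM !mulgA mulgVK. Qed.

Lemma csperm_comp x d s x' d' s' y :
  csperm x d s (csperm x' d' s' y) =
  csperm (x * sperm d s x') (fun i => d i (+) d' (s i)) (s * s') y.
Proof. by rewrite /csperm !spermM spermV sperm_comp invgM !mulgA. Qed.

Lemma eq_csperm x d d' s y : d =1 d' -> csperm x d s y = csperm x d' s y.
Proof. by move=> dd; rewrite /csperm (eq_sperm _ _ dd). Qed.

Lemma csperm_id d y : d =1 xpred0 -> csperm 1 d 1 y = y.
Proof.
by move=> d0; rewrite (eq_csperm _ _ _ d0) /csperm sperm_id mul1g invg1 mulg1.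
Qed.

(** For a signed permutation p, the inverse of p followed by conjugation by x is p^-1 followed by
    conjugation by p^-1(x^-1). *)
Definition csperm_inv x d s :=
  csperm (sperm (d \o s^-1) s^-1 x^-1) (d \o s^-1) s^-1.

Lemma cspermK x d s : cancel (csperm x d s) (csperm_inv x d s).
Proof.
move=> y; rewrite /csperm_inv csperm_comp -spermM mulVg (sperm_tpow _ _ false) mulVg.
by apply: csperm_id => i /=; rewrite addbb.
Qed.

Lemma csperm_invK x d s : cancel (csperm_inv x d s) (csperm x d s).
Proof.
move=> y; rewrite /csperm_inv csperm_comp sperm_comp mulgV.
rewrite (@eq_sperm _ _ xpred0) => [|i /=]; last by rewrite permK addbb.
rewrite sperm_id mulgV; apply: csperm_id => i /=.
by rewrite permK addbb.
Qed.

Lemma csperm_norm x d s y :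
  csperm x d s y = csperm (x * tpow (d ord0)) (ext (norm d)) s y.
Proof.
rewrite /csperm invgM !mulgA -(mulgA x (tpow _)) sperm_tpow_conj !mulgA mulgK.
congr (_ * _ * _); apply: eq_sperm => i.
by rewrite ext_norm -addbA addbb addbF.
Qed.

(** Uniqueness of the normal form: the alternative [x] = t would change the sign at [ord0], where
    both sign functions vanish. *)
Lemma csperm_inj x s e e' s' :
    (forall y, csperm x (ext e) s y = csperm 1 (ext e') s' y) ->
  [/\ x = 1, e = e' & s = s'].
Proof.
move=> E; have [|-> [[-> ee]|[_ /(_ ord0)]]] := @conj_sperm_inj _ x (ext e) s (ext e') s'.
- by move=> y; rewrite -/(csperm x _ _ y) E /csperm mul1g invg1 mulg1.
- by split=> //; apply: ext_inj.
- by rewrite !ext0.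
Qed.

Lemma injective_endo_normal_form (f : T -> T) :
    {morph f : x y / x * y} -> injective f ->
  exists x e s, f =1 csperm x (ext e) s.
Proof.
move=> fM fi; have [x [d [s fE]]] := twisted_injective_endo fM fi.
exists (x * tpow (d ord0)), (norm d), s => y.
by rewrite -csperm_norm fE.
Qed.

(** Normalizing the composite moves the constant [ext e' (s ord0)] into the conjugator as a power of
    t. The conjugator is displayed in the shape of the product in the iterated semidirect
    product. *)
Lemma csperm_normal_comp x e s x' e' s' y :
  csperm x (ext e) s (csperm x' (ext e') s' y) =
  csperm (x * sperm (ext e) 1 (sperm xpred0 s x' * tpow (ext e' (s ord0))))
    (ext [ffun j => e j (+) sign_act s e' j]) (s * s') y.
Proof.
rewrite csperm_comp csperm_norm ext0 addFb spermM sperm_comp sperm_tpow mul1g.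
rewrite mulgA (@eq_sperm _ _ (ext e)) => [|i]; last by rewrite addbF.
apply: eq_csperm => i; rewrite extD ext_sign_act ext_norm ext0 addFb.
by rewrite addbA.
Qed.

(** * The actions, and the automorphism and outer automorphism groups *)

Local Notation A := (Ln k.+3).

(** A pair [(w, e)] stands for [csperm (ln_eval w) (ext e) 1], and [s] conjugates it by
    [sperm xpred0 s]. The power of t compensates for normalizing the signs. *)
Definition sign_perm_act s (p : A * {ffun 'I_k -> bool}) :
    A * {ffun 'I_k -> bool} :=
  (ln_word (sperm xpred0 s (ln_eval p.1) * tpow (ext p.2 (s ord0))),
   sign_act s p.2).

Definition sign_word_act e (w : A) : A := ln_word (sperm (ext e) 1 (ln_eval w)).

Lemma ln_evalP (w v : A) : geq w v <-> ln_eval w = ln_eval v.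
Proof.
split=> [|wv]; first exact: ln_eval_rel.
have := ln_word_eval w; rewrite wv => vw.
exact: ln_trans (ln_sym vw) (ln_word_eval v).
Qed.

Lemma ln_eval_mul (w v : A) : ln_eval (gmul w v) = ln_eval w * ln_eval v.
Proof. exact: ln_eval_cat. Qed.

Lemma ln_eval_inv (w : A) : ln_eval (ginv w) = (ln_eval w)^-1.
Proof. exact: ln_eval_rev. Qed.

Definition ln_wordK : cancel (@ln_word k.+1 : T -> A) (@ln_eval k.+1) :=
  @ln_eval_word k.+1.

Definition aut_of x d s : auto A :=
  auto_of ln_evalP ln_eval_mul ln_wordK
    (@cspermM x d s) (@cspermK x d s) (@csperm_invK x d s).

Local Notation model := (@model A T (@ln_eval k.+1) (@ln_word k.+1)).

Lemma model_aut_of x d s : model (aut_of x d s) =1 csperm x d s.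
Proof. exact: model_auto_of. Qed.

Lemma aut_normal_form (a : auto A) :
  exists x e s, model a =1 csperm x (ext e) s.
Proof.
apply: injective_endo_normal_form.
  exact: (modelM ln_evalP ln_eval_mul ln_wordK).
exact: (model_inj ln_evalP ln_wordK).
Qed.

Lemma sign_word_act_action : @is_gaction A (Z2pow k) sign_word_act.
Proof.
apply: gaction_intro.
- move=> e e' w v /= <- wv; apply/ln_evalP.
  by rewrite /sign_word_act ((ln_evalP _ _).1 wv).
- move=> e w v; apply/ln_evalP.
  by rewrite ln_eval_mul /sign_word_act !ln_wordK ln_eval_mul spermM.
- move=> w; apply/ln_evalP; rewrite /sign_word_act ln_wordK.
  by rewrite (@eq_sperm _ _ xpred0) ?sperm_id // => i; rewrite ext_const0.
- move=> e e' w; apply/ln_evalP; rewrite /sign_word_act !ln_wordK sperm_comp mul1g.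
  by apply: eq_sperm => i; rewrite extD perm1.
- by move=> e; apply/ffunP => i; rewrite !ffunE addbb.
- by move=> e; apply/ffunP => i; rewrite !ffunE addbb.
Qed.

Lemma sign_act_action : @is_gaction (Z2pow k) (SymG k.+1) sign_act.
Proof.
apply: gaction_intro => /=.
- by move=> s s' e e' -> ->.
- exact: sign_actD.
- exact: sign_act1.
- exact: sign_actM.
- exact: mulVg.
- exact: mulgV.
Qed.

Local Notation N := (@semidir A (Z2pow k) sign_word_act).

Lemma sign_perm_act_action : @is_gaction N (SymG k.+1) sign_perm_act.
Proof.
apply: gaction_intro => /=.
- move=> s s' [w e] [v e'] /= <- [/= wv <-]; split=> //; apply/ln_evalP => /=.
  by rewrite ((ln_evalP _ _).1 wv).
- move=> s [w e] [v e']; split; last exact: sign_actD.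
  apply/ln_evalP; rewrite /= /sign_word_act [LHS]ln_wordK [RHS]ln_eval_cat.
  rewrite !ln_wordK ln_eval_cat ln_wordK spermM -!mulgA; congr (_ * _).
  rewrite sperm_comp extD tpowD spermM sperm_tpow sperm_comp mulg1 mul1g.
  (* Moving the power of t to the right adds [ext e (s ord0)] to all signs, which undoes the
     normalization in [sign_act s e]. *)
  rewrite !mulgA sperm_tpow_conj; congr (_ * _ * _).
  apply: eq_sperm => i; rewrite ext_sign_act addbF -addbA addbb addbF.
  by [].
- move=> [w e]; split; last exact: sign_act1.
  apply/ln_evalP; rewrite /= ln_wordK sperm_id perm1 ext0; exact: mulg1.
- move=> s s' [w e]; split; last exact: sign_actM.
  apply/ln_evalP; rewrite /= !ln_wordK spermM sperm_comp sperm_tpow -mulgA -tpowD.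
  congr (_ * tpow _); rewrite ext_sign_act permM addbCA addbb addbF.
  by [].
- exact: mulVg.
- exact: mulgV.
Qed.

Lemma aut_iso : iso (AutG A) (@semidir N (SymG k.+1) sign_perm_act).
Proof.
pose E (p : A * {ffun 'I_k -> bool} * 'S_k.+1) : AutG A :=
  aut_of (ln_eval p.1.1) (ext p.1.2) p.2.
have autP := auto_eqP ln_evalP ln_wordK.
apply: (@iso_of_bijection (@semidir N (SymG k.+1) sign_perm_act) (AutG A) E).
- move=> [[w e] s] [[v e'] s'] /= [/= [/= wv <-] <-]; apply/autP => y.
  by rewrite !model_aut_of ((ln_evalP _ _).1 wv).
- move=> [[w e] s] [[v e'] s'] /autP wv.
  (* Dividing by the second conjugator reduces the comparison to uniqueness of the normal form. *)
  have [|/= vw -> ->] // := @csperm_inj ((ln_eval v)^-1 * ln_eval w) s e e' s'.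
    move=> y; have := wv y; rewrite !model_aut_of /csperm /= => wvy.
    rewrite invgM invgK !mulgA -(mulgA _ (ln_eval w)) -(mulgA _ _ (ln_eval w)^-1) wvy.
    by rewrite !mulgA mulVg mulgVK invg1 mulg1.
  split; [split|] => //; apply/ln_evalP => /=.
  by rewrite -[ln_eval v]mulg1 -vw mulVKg.
- move=> [[w e] s] [[v e'] s']; apply/autP => y.
  rewrite (model_mul ln_evalP ln_wordK) !model_aut_of csperm_normal_comp.
  by rewrite /= /sign_word_act ln_eval_cat !ln_wordK.
- move=> a; have [x [e [s aE]]] := aut_normal_form a.
  exists (ln_word x, e, s); apply/autP => y.
  by rewrite model_aut_of aE /= ln_wordK.
- exact: (auto_mul_proper ln_evalP ln_wordK).
Qed.

Lemma out_iso : iso (OutG A) (@semidir (Z2pow k) (SymG k.+1) sign_act).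
Proof.
pose E (p : {ffun 'I_k -> bool} * 'S_k.+1) : OutG A := aut_of 1 (ext p.1) p.2.
have outP := out_eqP ln_evalP ln_eval_mul ln_eval_inv ln_wordK.
apply: (@iso_of_bijection (@semidir (Z2pow k) (SymG k.+1) sign_act) (OutG A) E).
- by move=> [e s] [e' s'] [/= <- <-]; exact: (@geq_refl (OutG A)).
- move=> [e s] [e' s'] /outP[x xP].
  have [|_ /= -> ->] // := @csperm_inj x^-1 s e e' s'.
  move=> y; have := xP y; rewrite !model_aut_of /csperm /= !mul1g !invg1 !mulg1 => ->.
  by rewrite invgK !mulgA mulVg mul1g mulgVK.
- move=> [e s] [e' s']; apply: geq_sym; apply/outP.
  (* [E] is multiplicative only up to the conjugator produced by normalizing the composite. *)
  exists (tpow (ext e' (s ord0))) => y.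
  rewrite (model_mul ln_evalP ln_wordK) !model_aut_of csperm_normal_comp.
  rewrite (sperm_tpow xpred0 s false) !mul1g sperm_tpow /csperm.
  by rewrite mul1g invg1 mulg1.
- move=> a; have [x [e [s aE]]] := aut_normal_form a.
  exists (e, s); apply: geq_sym; apply/outP; exists x => y.
  by rewrite model_aut_of aE /csperm mul1g invg1 mulg1.
- exact: (out_mul_proper ln_evalP ln_eval_mul ln_eval_inv ln_wordK).
Qed.

End NormalForm.

(** * The case of L_3 *)

Lemma aut_normal_form_L3 (a : auto (Ln 3)) :
  exists x, @model (Ln 3) (twisted 'I_1) (@ln_eval 1) (@ln_word 1) a =1
            csperm x (@ext 0 [ffun=> false]) 1%g.
Proof.
have [x [e [s aE]]] := @aut_normal_form 0 a; exists x => y; rewrite aE.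
(* ['I_0] is empty and S_1 is trivial, so only the conjugator remains: every automorphism is
   inner. *)
have -> : e = [ffun=> false] by apply/ffunP => -[].
by have -> : s = 1%g by apply/permP => i; rewrite !ord1.
Qed.

Lemma aut_L3_iso : iso (AutG (Ln 3)) (Ln 3).
Proof.
pose E (w : Ln 3) : auto (Ln 3) :=
  @aut_of 0 (ln_eval w) (@ext 0 [ffun=> false]) 1%g.
have autP := auto_eqP (@ln_evalP 0) (@ln_wordK 0).
apply: (@iso_of_bijection (Ln 3) (AutG (Ln 3)) E).
- move=> w v wv; apply/autP => y.
  by rewrite !model_aut_of (ln_eval_rel wv).
- move=> w v /autP wv; apply/ln_evalP.
  have [|/= vw _ _] // := @csperm_inj 0 ((ln_eval v)^-1 * ln_eval w)%g 1%g
                            [ffun=> false] [ffun=> false] 1%g.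
    move=> y; have := wv y; rewrite !model_aut_of /csperm /= => wvy.
    rewrite invgM invgK !mulgA -(mulgA _ (ln_eval w)).
    rewrite -(mulgA _ _ (ln_eval w)^-1)%g wvy.
    by rewrite !mulgA mulVg mulgVK invg1 mulg1.
  by rewrite -[RHS]mulg1 -vw mulVKg.
- move=> w v; apply/autP => y.
  rewrite (model_mul (@ln_evalP 0) (@ln_wordK 0)) !model_aut_of.
  rewrite csperm_normal_comp perm1 ext0 !mulg1 sperm_comp mulg1.
  rewrite (@eq_sperm _ _ xpred0) => [|i]; last by rewrite ext_const0.
  rewrite sperm_id ln_eval_cat; apply: eq_csperm => i.
  by rewrite extD ext_sign_act !ext_const0.
- move=> a; have [x aE] := aut_normal_form_L3 a.
  by exists (ln_word x); apply/autP => y; rewrite model_aut_of aE ln_eval_word.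
- exact: (auto_mul_proper (@ln_evalP 0) (@ln_wordK 0)).
Qed.

Lemma out_L3_trivial : iso (OutG (Ln 3)) trivial_grp.
Proof.
pose E (_ : trivial_grp) : auto (Ln 3) := auto_one (Ln 3).
have outP := out_eqP (@ln_evalP 0) (@ln_eval_mul 0) (@ln_eval_inv 0) (@ln_wordK 0).
apply: (@iso_of_bijection trivial_grp (OutG (Ln 3)) E).
- by move=> *; exact: (@geq_refl (OutG (Ln 3))).
- by case; case.
- move=> x y; apply/outP; exists 1%g => u.
  by rewrite /model mul1g invg1 mulg1.
- move=> a; have [x aE] := aut_normal_form_L3 a.
  exists tt; apply: geq_sym; apply/outP; exists x => u.
  rewrite aE /csperm (@eq_sperm _ _ xpred0) => [|i]; last by rewrite ext_const0.
  by rewrite sperm_id /model ln_eval_word.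
- exact: (out_mul_proper (@ln_evalP 0) (@ln_eval_mul 0) (@ln_eval_inv 0) (@ln_wordK 0)).
Qed.

Theorem theorem5p5 :
  iso (AutG (Ln 3)) (Ln 3) /\
  iso (OutG (Ln 3)) trivial_grp /\
  (forall n : nat, 4 <= n ->
     (exists (phi : Z2pow (n - 3) -> Ln n -> Ln n)
             (psi : SymG (n - 2) -> @semidir (Ln n) (Z2pow (n - 3)) phi ->
                                   @semidir (Ln n) (Z2pow (n - 3)) phi),
        is_gaction phi /\ is_gaction psi /\
        iso (AutG (Ln n))
            (@semidir (@semidir (Ln n) (Z2pow (n - 3)) phi) (SymG (n - 2)) psi)) /\
     (exists chi : SymG (n - 2) -> Z2pow (n - 3) -> Z2pow (n - 3),
        is_gaction chi /\
        iso (OutG (Ln n)) (@semidir (Z2pow (n - 3)) (SymG (n - 2)) chi))).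
Proof.
split; first exact: aut_L3_iso.
split; first exact: out_L3_trivial.
(* For n = k + 3 there are k + 1 generators of order 3: k signs remain modulo the global sign
   change, and S_(k+1) permutes the indices. *)
move=> n n4; have [k nE] : exists k, n = k.+3.
  by exists (n - 3); rewrite -[RHS]addn3 subnK // ltnW.
rewrite {n n4}nE (_ : k.+3 - 3 = k); last by rewrite subSS subSS subSS subn0.
rewrite (_ : k.+3 - 2 = k.+1); last by rewrite subSS subSS subn0.
split; last by exists (@sign_act k); split; [apply: sign_act_action|apply: out_iso].
exists (@sign_word_act k), (@sign_perm_act k); split; last split.
- exact: sign_word_act_action.
- exact: sign_perm_act_action.
- exact: aut_iso.
Qed.
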